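(* Let $D=\mathrm{diag}(d_1,d_2,d_3,d_4,d_5)$ with $d_1,\dots,d_5>0$ and let $H$ be the Horn matrix. Then $DHD$ belongs to $\mathcal K_5^{(1)}$ if and only if $$d_{i-1}d_i+d_id_{i+1}\ge d_{i-1}d_{i+1}\quad\text{for all } i\in\{1,2,3,4,5\},$$ where the indices are taken modulo $5$.
   Context: The Horn matrix is $$H=\begin{pmatrix}1&1&-1&-1&1\\1&1&1&-1&-1\\-1&1&1&1&-1\\-1&-1&1&1&1\\1&-1&-1&1&1\end{pmatrix}.$$ $\mathcal K_5^{(1)}$ is the set of real symmetric $5\times5$ matrices $M$ such that the polynomial $\big(\sum_{i=1}^5x_i^2\big)\sum_{i,j=1}^5M_{ij}x_i^2x_j^2$ is a finite sum of squares of real polynomials in $x_1,\dots,x_5$. *)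

(* Defs.v *)
From mathcomp Require Import all_boot all_order all_algebra.
From mathcomp Require Import reals.
From mathcomp Require Import mpoly.

Set Implicit Arguments.
Unset Strict Implicit.
Unset Printing Implicit Defensive.

Import Order.TTheory GRing.Theory Num.Theory.
Local Open Scope ring_scope.

Definition is_sos (R : realType) (n : nat) (p : {mpoly R[n]}) : Prop :=
  exists s : seq {mpoly R[n]}, p = \sum_(q <- s) q ^+ 2.

(* The cone K_n^(r) of symmetric matrices; r is the exponent of the multiplier
   x_1^2 + ... + x_n^2. *)
Definition parrilo_cone (R : realType) (n r : nat) (M : 'M[R]_n) : Prop :=
  M^T = M /\
  is_sos ((\sum_(i < n) 'X_i ^+ 2) ^+ r *
          \sum_(i < n) \sum_(j < n) M i j *: ('X_i ^+ 2 * 'X_j ^+ 2)).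

Definition horn_rows : seq (seq int) :=
  [:: [::  1;  1; -1; -1;  1];
      [::  1;  1;  1; -1; -1];
      [:: -1;  1;  1;  1; -1];
      [:: -1; -1;  1;  1;  1];
      [::  1; -1; -1;  1;  1]].

Definition horn_mx (R : realType) : 'M[R]_5 :=
  \matrix_(i, j) (nth 0 (nth [::] horn_rows i) j)%:~R.

(* Main.v *)
(** Put c_i = 1 / d_i and y_i = d_i x_i^2; the condition at i then reads
    c_i <= c_(i-1) + c_(i+1).  With l_i = y_i + y_(i+1) + y_(i-1) - y_(i+2)
    - y_(i-2), the Horn form equals l_i^2 + 4 (y_(i+1) y_(i+2) + y_(i-1) y_(i-2)
    - y_(i+1) y_(i-1)) for every i.  Multiplying by x_i^2 = c_i y_i and summing,
    the products of three y's collect into 4 (c_(i-1) + c_(i+1) - c_i)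
    y_(i-1) y_i y_(i+1), which is a square in x when the condition holds.

    Conversely, only the cubic parts F of the summands of a sum of squares
    contribute.  Each F vanishes at the zeros of the Horn form, and this forces
    its part odd in x_i and even in the other variables to be a multiple of
    x_i l_i.  Hence, in the coordinates sqrt(d_j) x_j and at the points
    (+-1, +-1, +-1) on three consecutive axes, the sign-odd components of F are
    F(e_(i-1)), 3 F(e_i), F(e_(i+1)) and a remainder, up to sign.
    Parseval for the signs, summed over all F, gives
    5 (c_(i-1) + c_i + c_(i+1)) >= c_(i-1) + 9 c_i + c_(i+1). *)

Require Import Defs.
From mathcomp Require Import all_boot all_order all_algebra.
From mathcomp Require Import reals.
From mathcomp Require Import mpoly.
From mathcomp Require Import ring lra.

Import Order.TTheory GRing.Theory Num.Theory.
Local Open Scope ring_scope.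

(** * Values of the homogeneous cubic part of a polynomial *)

Lemma mnm_deg3 (n : nat) (m : 'X_{1..n}) :
  mdeg m = 3 -> exists i j k : 'I_n, m = (U_(i) + U_(j) + U_(k))%MM.
Proof.
have split_mnm (m' : 'X_{1..n}) e :
    mdeg m' = e.+1 -> exists i m1, m' = (m1 + U_(i))%MM /\ mdeg m1 = e.
  move=> m'_deg; have [i m'i_gt0 | m'0] := pickP (fun i => 0 < m' i)%N; last first.
    suff : mdeg m' = 0 by rewrite m'_deg.
    by rewrite mdegE big1 // => i _; apply/eqP; rewrite -leqn0 leqNgt m'0.
  have Ui_le : (U_(i) <= m')%MM.
    by apply/mnm_lepP => j; rewrite mnm1E; case: eqP => // <-.
  exists i, (m' - U_(i))%MM; split; first by rewrite submK.
  by apply/eqP; rewrite -eqSS -m'_deg -{2}(submK Ui_le) mdegD mdeg1 addn1.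
move=> /split_mnm[k [m1 [-> /split_mnm[j [m2 [-> /split_mnm[i [m3 [->]]]]]]]]].
by move=> /eqP; rewrite mdeg_eq0 => /eqP ->; exists i, j, k; rewrite add0m.
Qed.

Definition along_ray {R : comNzRingType} {n : nat} (z : 'I_n -> R)
  (f : {mpoly R[n]}) : {poly R} := mmap polyC (fun i => z i *: 'X) f.

(** Since [along_ray z f] is f(z X), this is the value at z of the homogeneous component of degree 3
    of f. *)
Definition cubic_part {R : comNzRingType} {n : nat} (f : {mpoly R[n]})
  (z : 'I_n -> R) : R := (along_ray z f)`_3.

Lemma cubic_partE (R : comNzRingType) (n : nat) (f : {mpoly R[n]})
    (z : 'I_n -> R) :
  cubic_part f z =
    \sum_(m <- msupp f | mdeg m == 3) f@_m * \prod_(i < n) z i ^+ m i.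
Proof.
rewrite /cubic_part /along_ray /mmap coef_sum [RHS]big_mkcond /=.
apply: eq_bigr => m _; rewrite coefCM.
have -> : mmap1 (fun i => z i *: 'X) m =
    (\prod_(i < n) z i ^+ m i) *: 'X^(mdeg m).
  rewrite /mmap1 mdegE -prodrXr -scaler_prod.
  by apply: eq_bigr => i _; rewrite exprZn.
by rewrite coefZ coefXn eq_sym; case: eqP => _; rewrite ?mulr1 ?mulr0.
Qed.

(** Cubic monomials span the cubic forms, so a linear relation between values at given points need
    only be tested on products of three coordinates, where [ring] decides it. *)
Lemma cubic_part_relation (R : comNzRingType) (n : nat) (f : {mpoly R[n]})
    (r : seq (R * ('I_n -> R))) :
  (forall i j k : 'I_n,
     \sum_(q <- r) q.1 * (q.2 i * q.2 j * q.2 k) = 0) ->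
  \sum_(q <- r) q.1 * cubic_part f q.2 = 0.
Proof.
move=> r0; under eq_bigr do rewrite cubic_partE mulr_sumr.
rewrite exchange_big big1 // => m /eqP /mnm_deg3[i [j [k ->]]].
transitivity (f@_(U_(i) + U_(j) + U_(k)) *
    \sum_(q <- r) q.1 * (q.2 i * q.2 j * q.2 k)); last by rewrite r0 mulr0.
rewrite mulr_sumr.
apply: eq_bigr => q _.
rewrite mulrCA; congr (_ * (_ * _)).
have prodU (a : 'I_n) : \prod_(l < n) q.2 l ^+ U_(a)%MM l = q.2 a.
  rewrite (bigD1 a) //= mnm1E eqxx expr1 big1 ?mulr1 // => l la.
  by rewrite mnm1E eq_sym (negPf la).
by under eq_bigr do rewrite !mnmDE !exprD; rewrite !big_split /= !prodU.
Qed.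

(** While n > 0, the squares of the constant terms sum to 0, so X divides every summand; divide by
    X^2 and induct. *)
Lemma sum_sqr_monomial (R : realDomainType) (n : nat) (C : R)
    (s : seq {poly R}) :
  \sum_(g <- s) g ^+ 2 = C *: 'X^(n.*2) -> \sum_(g <- s) g`_n ^+ 2 = C.
Proof.
elim: n s => [|n IHn] s Es.
  have /(congr1 (fun p : {poly R} => p`_0)) := Es.
  rewrite coefZ coefXn mulr1 coef_sum => <-.
  by apply: eq_bigr => g _; rewrite coef0M.
have g0 : all (fun g : {poly R} => g`_0 ^+ 2 == 0) s.
  rewrite -(psumr_eq0 _ (P := xpredT)) => [|g _]; last exact: sqr_ge0.
  apply/eqP; have /(congr1 (fun p : {poly R} => p`_0)) := Es.
  rewrite coefZ coefXn mulr0 coef_sum; apply: etrans.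
  by apply: eq_bigr => g _; rewrite coef0M.
have {}g0 : {in s, forall g : {poly R}, g = drop_poly 1 g * 'X}.
  move=> g /(allP g0); rewrite sqrf_eq0 => /eqP g0_0.
  apply/polyP => -[|i]; rewrite coefMX ?coef_drop_poly //=.
  by rewrite addn1.
have : \sum_(g <- map (drop_poly 1) s) g ^+ 2 = C *: 'X^(n.*2).
  apply: (mulIf (x := 'X^2)); first by rewrite expf_neq0 ?polyX_eq0.
  rewrite -scalerAl -exprD addn2 -doubleS -Es big_map mulr_suml.
  by apply: eq_big_seq => g /g0 {2}->; rewrite exprMn.
move=> /IHn <-; rewrite big_map; apply: eq_bigr => g _.
by rewrite coef_drop_poly addn1.
Qed.

(** * The Horn form and the inequality forced by a sum of squares *)

Definition horn_form {A : comNzRingType} (y0 y1 y2 y3 y4 : A) : A :=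
  (y0 + y1 - y2 - y3 + y4) ^+ 2 + 4 * (y1 * y2 + y3 * y4 - y1 * y4).

Definition comb {R : comNzRingType} {n : nat} (u : nat -> 'I_n -> R)
    (x0 x1 x2 x3 x4 : R) (k : 'I_n) : R :=
  x0 * u 0%N k + x1 * u 1%N k + x2 * u 2 k + x3 * u 3 k + x4 * u 4 k.

Lemma cubic_part_opp (R : comNzRingType) (n : nat) (f : {mpoly R[n]})
    (z z' : 'I_n -> R) :
  (forall k, z' k = - z k) -> cubic_part f z' = - cubic_part f z.
Proof.
move=> z'E; have := cubic_part_relation _ _ f [:: (1, z); (1, z')].
rewrite !big_cons !big_nil /= !mul1r addr0 => opp0.
apply/eqP; rewrite -addr_eq0 addrC opp0 // => i j k.
by rewrite !big_cons big_nil /= !z'E; ring.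
Qed.

(* With r_u, r_v, r_w the coefficients of a^3, a b^2, a c^2 in F (z a b c), the
   zeros (1, 0, +-1) give r_u + r_w = 0, and then the Pythagorean zeros
   (3, +-4, +-5) give r_v = r_u. *)
Lemma cubic_part_pair (R : realFieldType) (n : nat) (f : {mpoly R[n]})
    (z : R -> R -> R -> 'I_n -> R) (u v w : 'I_n -> R) :
  (forall a b c k, z a b c k = a * u k + b * v k + c * w k) ->
  (forall a b c, a ^+ 2 + b ^+ 2 = c ^+ 2 -> cubic_part f (z a b c) = 0) ->
  cubic_part f (z 1 1 0) + cubic_part f (z 1 (-1) 0) =
    4 * cubic_part f (z 1 0 0).
Proof.
move=> zE z0.
(* The sign sum over (3, +-4, +-5) is 108 r_u + 192 r_v + 300 r_w. The weights -96 and -150 cancel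
   r_v and r_w, and 384 cancels the r_u that is left. *)
have : \sum_(q <- [:: (1, z 3 4 5); (1, z 3 (-4) 5); (1, z 3 4 (-5));
      (1, z 3 (-4) (-5)); (- 96, z 1 1 0); (- 96, z 1 (-1) 0);
      (- 150, z 1 0 1); (- 150, z 1 0 (-1)); (384, z 1 0 0)])
    q.1 * cubic_part f q.2 = 0.
  apply: cubic_part_relation => i j k.
  by rewrite !big_cons big_nil /= !zE; ring.
rewrite !big_cons big_nil /=.
rewrite (z0 3 4 5) ?(z0 3 (-4) 5) ?(z0 3 4 (-5)) ?(z0 3 (-4) (-5)); try by ring.
rewrite (z0 1 0 1) ?(z0 1 0 (-1)); try by ring.
lra.
Qed.

(** Summing over the signs of b and c leaves only the terms in a^3, a b^2 and a c^2. The planes c =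
    0 and b = 0 supply these, counting a^3 once too often. *)
Lemma cubic_part_signs (R : comNzRingType) (n : nat) (f : {mpoly R[n]})
    (z : R -> R -> R -> 'I_n -> R) (u v w : 'I_n -> R) :
  (forall a b c k, z a b c k = a * u k + b * v k + c * w k) ->
  cubic_part f (z 1 1 1) + cubic_part f (z 1 1 (-1)) +
    cubic_part f (z 1 (-1) 1) + cubic_part f (z 1 (-1) (-1)) =
  2 * (cubic_part f (z 1 1 0) + cubic_part f (z 1 (-1) 0)) +
    2 * (cubic_part f (z 1 0 1) + cubic_part f (z 1 0 (-1))) -
    4 * cubic_part f (z 1 0 0).
Proof.
move=> zE.
have rel : \sum_(q <- [:: (1, z 1 1 1); (1, z 1 1 (-1)); (1, z 1 (-1) 1);
      (1, z 1 (-1) (-1)); (- 2, z 1 1 0); (- 2, z 1 (-1) 0); (- 2, z 1 0 1);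
      (- 2, z 1 0 (-1)); (4, z 1 0 0)]) q.1 * cubic_part f q.2 = 0.
  apply: cubic_part_relation => i j k.
  by rewrite !big_cons big_nil /= !zE; ring.
apply/eqP; rewrite -subr_eq0; apply/eqP.
by rewrite -[RHS]rel !big_cons big_nil /=; ring.
Qed.

Lemma sos_consecutive_coef_le (R : realFieldType) (n : nat) (s : seq {mpoly R[n]})
    (u : nat -> 'I_n -> R) (c0 c1 c2 c3 c4 : R) :
  (forall x0 x1 x2 x3 x4 : R,
     \sum_(f <- s) cubic_part f (comb u x0 x1 x2 x3 x4) ^+ 2 =
     (c0 * x0 ^+ 2 + c1 * x1 ^+ 2 + c2 * x2 ^+ 2 + c3 * x3 ^+ 2 + c4 * x4 ^+ 2)
     * horn_form (x0 ^+ 2) (x1 ^+ 2) (x2 ^+ 2) (x3 ^+ 2) (x4 ^+ 2)) ->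
  c1 <= c0 + c2.
Proof.
move=> sosE; pose G f x0 x1 x2 x3 x4 := cubic_part f (comb u x0 x1 x2 x3 x4).
have G0 f x0 x1 x2 x3 x4 : f \in s ->
    horn_form (x0 ^+ 2) (x1 ^+ 2) (x2 ^+ 2) (x3 ^+ 2) (x4 ^+ 2) = 0 ->
    G f x0 x1 x2 x3 x4 = 0.
  move=> fs h0; have /eqP := sosE x0 x1 x2 x3 x4.
  rewrite h0 mulr0 psumr_eq0 => [|g _]; last exact: sqr_ge0.
  by move=> /allP /(_ f fs); rewrite /= sqrf_eq0 => /eqP.
have parseval f : f \in s ->
    4 * (G f 1 0 0 0 0 ^+ 2 + 9 * G f 0 1 0 0 0 ^+ 2 + G f 0 0 1 0 0 ^+ 2) <=
    G f 1 1 1 0 0 ^+ 2 + G f 1 1 (-1) 0 0 ^+ 2 +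
      G f 1 (-1) 1 0 0 ^+ 2 + G f (-1) 1 1 0 0 ^+ 2.
  move=> fs.
  (* For two adjacent axes the third one is the axis adjacent to neither; there the Horn form is
     (a^2 + b^2 - c^2)^2. *)
  have pair01 : G f 1 1 0 0 0 + G f 1 (-1) 0 0 0 = 4 * G f 1 0 0 0 0.
    apply: (cubic_part_pair _ _ f (fun a b c => comb u a b 0 c 0)
      (u 0) (u 1) (u 3)) => [a b c k|a b c abc]; first by rewrite /comb; ring.
    by apply: G0; rewrite // /horn_form -abc; ring.
  have pair10 : G f 1 1 0 0 0 + G f (-1) 1 0 0 0 = 4 * G f 0 1 0 0 0.
    apply: (cubic_part_pair _ _ f (fun a b c => comb u b a 0 c 0)
      (u 1) (u 0) (u 3)) => [a b c k|a b c abc]; first by rewrite /comb; ring.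
    by apply: G0; rewrite // /horn_form -abc; ring.
  have pair12 : G f 0 1 1 0 0 + G f 0 1 (-1) 0 0 = 4 * G f 0 1 0 0 0.
    apply: (cubic_part_pair _ _ f (fun a b c => comb u 0 a b 0 c)
      (u 1) (u 2) (u 4)) => [a b c k|a b c abc]; first by rewrite /comb; ring.
    by apply: G0; rewrite // /horn_form -abc; ring.
  have pair21 : G f 0 1 1 0 0 + G f 0 (-1) 1 0 0 = 4 * G f 0 0 1 0 0.
    apply: (cubic_part_pair _ _ f (fun a b c => comb u 0 b a 0 c)
      (u 2) (u 1) (u 4)) => [a b c k|a b c abc]; first by rewrite /comb; ring.
    by apply: G0; rewrite // /horn_form -abc; ring.
  have pair02 : [/\ G f 1 0 1 0 0 = 0, G f 1 0 (-1) 0 0 = 0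
      & G f (-1) 0 1 0 0 = 0].
    by split; apply: G0; rewrite // /horn_form; ring.
  have opp0 : G f 1 (-1) (-1) 0 0 = - G f (-1) 1 1 0 0.
    by apply: cubic_part_opp => k; rewrite /comb; ring.
  have opp1 : G f (-1) 1 (-1) 0 0 = - G f 1 (-1) 1 0 0.
    by apply: cubic_part_opp => k; rewrite /comb; ring.
  have opp2 : G f (-1) (-1) 1 0 0 = - G f 1 1 (-1) 0 0.
    by apply: cubic_part_opp => k; rewrite /comb; ring.
  have [z02 z02' z20] := pair02.
  have := cubic_part_signs _ _ f (fun a b c => comb u a b c 0 0) (u 0) (u 1) (u 2).
  have := cubic_part_signs _ _ f (fun a b c => comb u b a c 0 0) (u 1) (u 0) (u 2).
  have := cubic_part_signs _ _ f (fun a b c => comb u c b a 0 0) (u 2) (u 1) (u 0).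
  rewrite -!/(G _ _ _ _ _ _) opp0 opp1 opp2 z02 z02' z20.
  rewrite pair01 pair10 pair12 pair21.
  move=> /(_ _)-s2 /(_ _)-s1 /(_ _)-s0.
  (* An end axis has one adjacent partner and one pair of zeros, giving 8 + 0 - 4 = 4; the middle
     axis has two adjacent partners, giving 8 + 8 - 4 = 12. *)
  have {}s0 : G f 1 1 1 0 0 + G f 1 1 (-1) 0 0 + G f 1 (-1) 1 0 0
      - G f (-1) 1 1 0 0 = 4 * G f 1 0 0 0 0.
    by rewrite s0 => [|a b c k]; [ring | rewrite /comb; ring].
  have {}s1 : G f 1 1 1 0 0 + G f 1 1 (-1) 0 0 + G f (-1) 1 1 0 0
      - G f 1 (-1) 1 0 0 = 12 * G f 0 1 0 0 0.
    by rewrite s1 => [|a b c k]; [ring | rewrite /comb; ring].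
  have {}s2 : G f 1 1 1 0 0 + G f (-1) 1 1 0 0 + G f 1 (-1) 1 0 0
      - G f 1 1 (-1) 0 0 = 4 * G f 0 0 1 0 0.
    by rewrite s2 => [|a b c k]; [ring | rewrite /comb; ring].
  (* This is the fourth sign combination, orthogonal to the other three; the four squares add up to
     4 times the sum of the squared values. *)
  have := sqr_ge0 (G f 1 1 1 0 0 - G f 1 1 (-1) 0 0 - G f 1 (-1) 1 0 0
    - G f (-1) 1 1 0 0).
  have := congr1 (fun t => t ^+ 2) s0.
  have := congr1 (fun t => t ^+ 2) s1.
  have := congr1 (fun t => t ^+ 2) s2.
  rewrite /=; lra.
have : \sum_(f <- s) 4 * (G f 1 0 0 0 0 ^+ 2 + 9 * G f 0 1 0 0 0 ^+ 2 +
                          G f 0 0 1 0 0 ^+ 2) <=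
    \sum_(f <- s) (G f 1 1 1 0 0 ^+ 2 + G f 1 1 (-1) 0 0 ^+ 2 +
      G f 1 (-1) 1 0 0 ^+ 2 + G f (-1) 1 1 0 0 ^+ 2).
  by rewrite !big_seq; apply: ler_sum.
(* The Horn form is 1 at each unit vector and 5 at the four sign points. *)
rewrite !(big_split, =^~ mulr_sumr) /= /G !sosE /horn_form; lra.
Qed.

(** * Cyclic indices modulo 5 and the Horn matrix *)

Lemma sum_ord5 (V : nmodType) (F : 'I_5 -> V) :
  \sum_(i < 5) F i =
    F (inord 0) + F (inord 1) + F (inord 2) + F (inord 3) + F (inord 4).
Proof.
rewrite !big_ord_recr big_ord0 /= add0r.
by congr (F _ + F _ + F _ + F _ + F _); apply: val_inj; rewrite /= inordK.
Qed.

Lemma all_ord5 (P : 'I_5 -> Prop) :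
  P (inord 0) -> P (inord 1) -> P (inord 2) -> P (inord 3) -> P (inord 4) ->
  forall i, P i.
Proof.
move=> P0 P1 P2 P3 P4 [[|[|[|[|[|//]]]]] lti];
  [move: P0|move: P1|move: P2|move: P3|move: P4];
  by congr P; apply: val_inj; rewrite /= inordK.
Qed.

Lemma ordS5 :
  (ordS (inord 0 : 'I_5) = inord 1) * (ordS (inord 1 : 'I_5) = inord 2) *
  (ordS (inord 2 : 'I_5) = inord 3) * (ordS (inord 3 : 'I_5) = inord 4) *
  (ordS (inord 4 : 'I_5) = inord 0).
Proof. by do ![split]; apply: val_inj; rewrite /= !inordK. Qed.

Lemma ord_pred5 :
  (ord_pred (inord 0 : 'I_5) = inord 4) *
  (ord_pred (inord 1 : 'I_5) = inord 0) *
  (ord_pred (inord 2 : 'I_5) = inord 1) *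
  (ord_pred (inord 3 : 'I_5) = inord 2) *
  (ord_pred (inord 4 : 'I_5) = inord 3).
Proof. by do ![split]; apply: val_inj; rewrite /= !inordK. Qed.

Lemma sum_cyclic5 (V : nmodType) (F : 'I_5 -> V) (i : 'I_5) :
  \sum_(k < 5) F k = F (ord_pred i) + F i + F (ordS i) + F (ordS (ordS i)) +
    F (ordS (ordS (ordS i))).
Proof.
rewrite sum_ord5; move: i; apply: all_ord5; rewrite ?ord_pred5 ?ordS5.
- by do 4 rewrite -!addrA [LHS]addrC !addrA.
- by [].
- by do 1 rewrite -!addrA [LHS]addrC !addrA.
- by do 2 rewrite -!addrA [LHS]addrC !addrA.
- by do 3 rewrite -!addrA [LHS]addrC !addrA.
Qed.

Lemma horn_mx_sym (R : realType) : (horn_mx R)^T = horn_mx R.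
Proof.
apply/matrixP => i j; rewrite !mxE.
by move: i j; do 2 apply: all_ord5; rewrite !inordK.
Qed.

(** The Horn matrix is circulant, so any index i can take the second place. The algebra [A] covers
    both real points and polynomials. *)
Lemma horn_quadE (R : realType) (A : comAlgType R) (y : 'I_5 -> A) (i : 'I_5) :
  \sum_(j < 5) \sum_(k < 5) horn_mx R j k *: (y j * y k) =
  horn_form (y (ord_pred i)) (y i) (y (ordS i)) (y (ordS (ordS i)))
    (y (ordS (ordS (ordS i)))).
Proof.
rewrite !sum_ord5 !mxE !inordK //= !(mulr1z, mulrN1z) !(scaleN1r, scale1r).
move: i; apply: all_ord5; rewrite ?ord_pred5 ?ordS5 /horn_form.
all: move: (y (inord 0)) (y (inord 1)) (y (inord 2)) (y (inord 3)) (y (inord 4)).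
all: move=> *; ring.
Qed.

Lemma scaled_horn_quadE (R : realType) (A : comAlgType R) (d : 'rV[R]_5)
    (x : 'I_5 -> A) (i : 'I_5) (y := fun k => d 0 k *: x k ^+ 2) :
  \sum_(j < 5) \sum_(k < 5)
    (diag_mx d *m horn_mx R *m diag_mx d) j k *: (x j ^+ 2 * x k ^+ 2) =
  horn_form (y (ord_pred i)) (y i) (y (ordS i)) (y (ordS (ordS i)))
    (y (ordS (ordS (ordS i)))).
Proof.
rewrite -horn_quadE; apply: eq_bigr => j _; apply: eq_bigr => k _.
rewrite mul_mx_diag mul_diag_mx /y !mxE -scalerAl -scalerAr !scalerA.
by congr (_ *: _); ring.
Qed.

Lemma comb_cyclic5 (R : comNzRingType) (c : 'I_5 -> R) (i : 'I_5)
    (x0 x1 x2 x3 x4 : R)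
    (z := comb (fun j k => if k == iter j (@ordS 5) (ord_pred i) then c k else 0)
            x0 x1 x2 x3 x4) :
  [/\ z (ord_pred i) = x0 * c (ord_pred i), z i = x1 * c i,
      z (ordS i) = x2 * c (ordS i), z (ordS (ordS i)) = x3 * c (ordS (ordS i))
    & z (ordS (ordS (ordS i))) = x4 * c (ordS (ordS (ordS i)))].
Proof.
rewrite {}/z /comb /=; move: i; apply: all_ord5; rewrite ?ord_pred5 ?ordS5.
all: by split; rewrite -!val_eqE /= !inordK //= !mulr0 ?addr0 ?add0r.
Qed.

(** * Restriction to rays and the equivalence *)

Lemma along_rayE (R : comNzRingType) (n : nat) (M : 'M[R]_n) (z : 'I_n -> R) :
  along_ray z ((\sum_(i < n) 'X_i ^+ 2) ^+ 1 *
    \sum_(i < n) \sum_(j < n) M i j *: ('X_i ^+ 2 * 'X_j ^+ 2)) =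
  ((\sum_(i < n) z i ^+ 2) *
    \sum_(i < n) \sum_(j < n) M i j *: (z i ^+ 2 * z j ^+ 2 : R^o)) *: 'X^6.
Proof.
have sqrE i : along_ray z ('X_i ^+ 2) = z i ^+ 2 *: 'X^2.
  by rewrite /along_ray rmorphXn /= mmapX mmap1U exprZn.
have -> f g : along_ray z (f * g) = along_ray z f * along_ray z g.
  exact: rmorphM.
have -> : along_ray z ((\sum_(i < n) 'X_i ^+ 2) ^+ 1) =
    (\sum_(i < n) z i ^+ 2) *: 'X^2.
  rewrite expr1 /along_ray rmorph_sum scaler_suml.
  by apply: eq_bigr => i _; apply: sqrE.
have -> : along_ray z
      (\sum_(i < n) \sum_(j < n) M i j *: ('X_i ^+ 2 * 'X_j ^+ 2)) =
    (\sum_(i < n) \sum_(j < n) M i j *: (z i ^+ 2 * z j ^+ 2 : R^o)) *: 'X^4.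
  rewrite /along_ray rmorph_sum scaler_suml; apply: eq_bigr => i _.
  rewrite rmorph_sum scaler_suml; apply: eq_bigr => j _ /=.
  rewrite mmapZ rmorphM /= -!/(along_ray z _) !sqrE mul_polyC.
  by rewrite -scalerAl -scalerAr !scalerA -exprD mulrA.
by rewrite -scalerAl -scalerAr scalerA -exprD.
Qed.

(* [ordS] and [ord_pred] are the cyclic successor and predecessor on ['I_5]. *)
Theorem theorem3p8 (R : realType) (d : 'rV[R]_5)
    (d_gt0 : forall i : 'I_5, 0 < d 0 i) :
  parrilo_cone 1 (diag_mx d *m horn_mx R *m diag_mx d) <->
  (forall i : 'I_5,
     d 0 (ord_pred i) * d 0 (ordS i)
       <= d 0 (ord_pred i) * d 0 i + d 0 i * d 0 (ordS i)).
Proof.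
split=> [[_ [s sosE]] i | d_ineq].
  (* Rescaling the axes by [c k] turns d_k x_k^2 into a plain square and gives the multiplier the
     coefficients 1 / d_k. *)
  pose c k : R := (Num.sqrt (d 0 k))^-1.
  have dc k x : d 0 k * (x * c k) ^+ 2 = x ^+ 2.
    rewrite exprMn exprVn sqr_sqrtr ?ltW // mulrCA mulfV ?mulr1 //.
    exact: lt0r_neq0.
  pose u j k : R := if k == iter j (@ordS 5) (ord_pred i) then c k else 0.
  have : (d 0 i)^-1 <= (d 0 (ord_pred i))^-1 + (d 0 (ordS i))^-1.
    apply: (sos_consecutive_coef_le _ _ s u _ _ _ (d 0 (ordS (ordS i)))^-1
      (d 0 (ordS (ordS (ordS i))))^-1) => x0 x1 x2 x3 x4.
    pose z := comb u x0 x1 x2 x3 x4.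
    have -> : \sum_(f <- s) cubic_part f z ^+ 2 =
        (\sum_(k < 5) z k ^+ 2) * \sum_(j < 5) \sum_(k < 5)
          (diag_mx d *m horn_mx R *m diag_mx d) j k *:
            (z j ^+ 2 * z k ^+ 2 : R^o).
      (* On a ray the sextic form is a multiple of X^6, so only the X^3 coefficients of the summands
         count. *)
      rewrite -[RHS](sum_sqr_monomial _ 3 _ (map (along_ray z) s)) ?big_map //.
      rewrite -along_rayE sosE /along_ray rmorph_sum /=.
      by apply: eq_bigr => f _; rewrite rmorphXn.
    rewrite (scaled_horn_quadE _ R^o d z i) (sum_cyclic5 _ _ i).
    have [] := comb_cyclic5 _ c i x0 x1 x2 x3 x4.
    rewrite -/u -/z => -> -> -> -> ->.
    rewrite /GRing.scale /= !dc; congr (_ * _).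
    by rewrite !exprMn !exprVn !sqr_sqrtr ?ltW //; ring.
  have := d_gt0 i; have := d_gt0 (ord_pred i); have := d_gt0 (ordS i).
  move: (d 0 i) (d 0 (ord_pred i)) (d 0 (ordS i)) => b a e e0 a0 b0.
  rewrite -subr_ge0 => /(mulr_ge0 (ltW (mulr_gt0 a0 (mulr_gt0 b0 e0)))).
  rewrite (_ : _ * (b * e) * _ = a * b + b * e - a * e) ?subr_ge0 //.
  by field; rewrite !lt0r_neq0.
split.
  by rewrite !trmx_mul tr_diag_mx horn_mx_sym mulmxA.
pose y k : {mpoly R[5]} := d 0 k *: 'X_k ^+ 2.
(* [t k] is (1/d_(k-1) + 1/d_(k+1) - 1/d_k) d_(k-1) d_k d_(k+1), which makes [h k] a square root of
   the k-th product term. *)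
pose t k := d 0 (ord_pred k) * d 0 k + d 0 k * d 0 (ordS k)
  - d 0 (ord_pred k) * d 0 (ordS k).
pose g k : {mpoly R[5]} := 'X_k * (y (ord_pred k) + y k + y (ordS k)
  - y (ordS (ordS k)) - y (ordS (ordS (ordS k)))).
pose h k : {mpoly R[5]} := (2 * Num.sqrt (t k)) *:
  ('X_(ord_pred k) * 'X_k * 'X_(ordS k)).
exists ([seq g k | k <- index_enum 'I_5] ++ [seq h k | k <- index_enum 'I_5]).
have hE k : h k ^+ 2 =
    4 * (t k)%:MP * ('X_(ord_pred k) * 'X_k * 'X_(ordS k)) ^+ 2.
  rewrite exprZn exprMn sqr_sqrtr ?subr_ge0 ?d_ineq // -mul_mpolyC.
  by rewrite mpolyCM -natrX mpolyC_nat.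
rewrite big_cat !big_map /= (eq_bigr _ (fun k _ => hE k)) expr1.
rewrite (scaled_horn_quadE _ _ _ _ (inord 0)) !sum_ord5 /g /y /t /horn_form.
rewrite !ord_pred5 !ordS5 -!mul_mpolyC !(mpolyCD, mpolyCN, mpolyCM).
move: (d 0 (inord 0))%:MP (d 0 (inord 1))%:MP (d 0 (inord 2))%:MP.
move: (d 0 (inord 3))%:MP (d 0 (inord 4))%:MP.
move: 'X_(inord 0) 'X_(inord 1) 'X_(inord 2) 'X_(inord 3) 'X_(inord 4).
by move=> *; ring.
Qed.
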